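(* Let $G$ be a group generated by a subgroup $K$ and a finite set $X\subset G$. Let $\varphi$ be a quasimorphism on $K$ that extends to a quasimorphism on $G$ (i.e. there is a quasimorphism $\psi$ on $G$ with $\psi|_K=\varphi$). Then $\varphi$ is linearly $(G,X)$-controlled, i.e. linearly $(G,X)$-controlled with some constant $C_0$.
   Context: A quasimorphism on a group $G$ is a function $\varphi:G\to\mathbb R$ with finite defect $D(\varphi):=\sup_{g,h\in G}|\varphi(g)+\varphi(h)-\varphi(gh)|$. Let $F(X)$ be the free group with basis $X$. Every $a\in K*F(X)$ has a unique shortest expression (its normal form) as a word in letters from $K\setminus\{1\}$ and $X\cup X^{-1}$; $|a|$ is the length of this word. Let $\theta:K*F(X)\to G$ be the natural projection and let $\eta:K*F(X)\to K$ be the homomorphism that is the identity on $K$ and sends every $x\in X$ to $1$. For a quasimorphism $\varphi$ on $K$ put $\tilde\varphi:=\varphi\circ\eta$, i.e. $\tilde\varphi(a)=\varphi(\prod_i k_i)$, where the $k_i$ are the $K$-letters of the normal form of $a$ in order. $\varphi$ is $(G,X)$-controlled by a function $f:\mathbb N\to\mathbb R$ if $|\tilde\varphi(a)|\le f(n)$ for every $n$ and every $a\in\ker(\theta)$ with $|a|\le n$. It is linearly $(G,X)$-controlled with a constant $C_0$ if it is $(G,X)$-controlled by $f(n)=C_0n+C_0$. *)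

(* Defs.v *)
From HB Require Import structures.
Set Warnings "-notation-incompatible-prefix,-notation-overridden,-ambiguous-paths,-redundant-canonical-projection,-projection-no-head-constant".
From mathcomp Require Import all_boot all_order all_algebra finmap.
From mathcomp Require Import all_classical all_reals ereal.

Set Implicit Arguments.
Unset Strict Implicit.
Unset Printing Implicit Defensive.

Import Order.TTheory GRing.Theory Num.Theory.

Local Open Scope group_scope.

Section FreeProduct.
Variables (K : groupType) (X : choiceType).

(* [inl k] is the letter k of K; [inr (x, false)] is x and [inr (x, true)] is
   the formal inverse of x *)
Definition letter : Type := (K + X * bool)%type.

Implicit Types (l : letter) (w u v : seq letter).

Definition nontrivial l := if l is inl k then k != 1 else true.

Definition compatible l l' :=
  match l, l' with
  | inl _, inl _ => false
  | inr (x, b), inr (y, c) => ~~ ((x == y) && (b != c))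
  | _, _ => true
  end.

Definition reduced w := all nontrivial w && sorted compatible w.

(* the elements of K * F(X), represented by their normal forms; the lemmas
   [freeprod_lift_*] below are the universal property of K * F(X), and
   [normal_form_shortest] identifies the normal form among all words *)
Record freeprod := FreeProd { normal_form : seq letter; _ : reduced normal_form }.

HB.instance Definition _ := [isSub for normal_form].
HB.instance Definition _ := [Choice of freeprod by <:].

(* normal form of l w, for w reduced *)
Definition push l w :=
  match l, w with
  | inl k, inl k' :: w' =>
      if k == 1 then w else
      if k * k' == 1 then w' else inl (k * k') :: w'
  | inl k, _ => if k == 1 then w else l :: w
  | inr (x, b), inr (y, c) :: w' =>
      if (x == y) && (b != c) then w' else l :: w
  | inr _, _ => l :: w
  end.

Definition act u w := foldr push w u.

Definition invl l : letter :=
  match l with inl k => inl k^-1 | inr (x, b) => inr (x, ~~ b) end.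

Definition invw w := rev (map invl w).

Lemma reduced_cons l w :
  reduced (l :: w) = [&& nontrivial l,
                        (if w is l' :: _ then compatible l l' else true)
                      & reduced w].
Proof.
rewrite /reduced /= -andbA; congr (_ && _).
by case: w => [|l' w] //=; rewrite andbCA.
Qed.

Lemma push_reduced l w : reduced w -> reduced (push l w).
Proof.
case: l => [k|[x b]]; case: w => [|[k'|[y c]] w] /=.
- by case: ifP => // k1; rewrite reduced_cons /= k1.
- case: ifP => // k1; case: ifP => kk rw; move: (rw); rewrite !reduced_cons /=.
    by case/and3P.
  by case/and3P=> _; rewrite kk; case: w rw => [|[?|[??]] ?].
- by case: ifP => // k1 rw; rewrite reduced_cons /= k1.
- by move=> _; rewrite reduced_cons.
- by move=> rw; rewrite reduced_cons.
- case: ifP => [_|xy rw]; first by rewrite reduced_cons => /and3P[].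
  by rewrite reduced_cons /= xy.
Qed.

Lemma push_cons l w : reduced (l :: w) -> push l w = l :: w.
Proof.
rewrite reduced_cons; case: l => [k|[x b]]; case: w => [|[k'|[y c]] w] //=.
- by case: (k == 1).
- by rewrite andbF.
- by case: (k == 1).
- by case: ifP.
Qed.

Lemma push1 w : push (inl 1) w = w.
Proof. by case: w => [|[k'|[y c]] w] /=; rewrite eqxx. Qed.

Lemma pushM k k' w : reduced w ->
  push (inl k) (push (inl k') w) = push (inl (k * k')) w.
Proof.
have [->|k1] := eqVneq k 1; first by rewrite mul1g push1.
have [->|k'1] := eqVneq k' 1; first by rewrite mulg1 push1.
case: w => [|[h|[y c]] w]; rewrite ?reduced_cons /= (negPf k'1) /=;
  rewrite ?(negPf k1) //.
case/and3P=> h1 cw _; have [kh1|kh1] := eqVneq (k' * h) 1; last first.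
  rewrite mulgA; case: (eqVneq (k * k') 1) => [->|//].
  by rewrite mul1g (negPf h1).
have -> : h = k'^-1 by apply: (mulgI k'); rewrite mulgV.
rewrite mulgK; have [kk1|kk1] := eqVneq (k * k') 1.
  have -> : k'^-1 = k by apply: (mulIg k'); rewrite mulVg.
  by case: w cw => [|[g|[y c]] w] //=.
by rewrite (negPf k1); case: w cw => [|[g|[y c]] w].
Qed.

Lemma pushV x b w : reduced w -> push (inr (x, b)) (push (inr (x, ~~ b)) w) = w.
Proof.
case: w => [|[h|[y c]] w] rw /=; rewrite ?eqxx ?negbK /= ?eqb_id;
  do ?[by case: b].
case: ifP => [/andP[/eqP-> /eqP bc]|_]; last by rewrite eqxx /=; case: b.
have -> : b = c by move: bc; case: (b); case: (c).
exact: push_cons rw.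
Qed.

Lemma act_reduced u w : reduced w -> reduced (act u w).
Proof. by move=> rw; elim: u => //= l u /push_reduced. Qed.

Lemma act_nil w : reduced w -> act w [::] = w.
Proof.
elim: w => //= l w IHw rlw; rewrite IHw ?push_cons //.
by move: rlw; rewrite reduced_cons => /and3P[].
Qed.

#[local] Arguments push : simpl never.

Lemma act_push l u w : reduced u -> reduced w ->
  act (push l u) w = push l (act u w).
Proof.
move=> ru rw; case: l => [k|[x b]]; case: u ru => [|[k'|[y c]] u] ru;
  rewrite [X in act X]/push /=.
- by case: eqVneq => [->|//]; rewrite push1.
- case: eqVneq => [->|_]; first by rewrite push1.
  rewrite pushM ?act_reduced //.
  by case: eqVneq => [->|//]; rewrite push1.
- by case: eqVneq => [->|//]; rewrite push1.
- by [].
- by [].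
- case: ifP => [/andP[/eqP-> /eqP bc]|//].
  have -> : c = ~~ b by move: bc; case: (b); case: (c).
  by rewrite pushV ?act_reduced.
Qed.

Lemma act_act u v w : reduced v -> reduced w ->
  act (act u v) w = act u (act v w).
Proof.
move=> rv rw; elim: u => //= l u IHu.
by rewrite act_push ?act_reduced // IHu.
Qed.

Lemma act_cat u v w : act (u ++ v) w = act u (act v w).
Proof. exact: foldr_cat. Qed.

Lemma invlK : involutive invl.
Proof. by case=> [k|[x b]] /=; rewrite ?invgK ?negbK. Qed.

Lemma invwK : involutive invw.
Proof.
by move=> w; rewrite /invw map_rev revK -map_comp map_id_in // => l _ /=;
  rewrite invlK.
Qed.

Lemma push_invl l w : reduced w -> push (invl l) (push l w) = w.
Proof.
case: l => [k|[x b]] rw; first by rewrite pushM // mulVg push1.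
by rewrite -{2}[b]negbK pushV.
Qed.

Lemma act_invw u w : reduced w -> act (invw u) (act u w) = w.
Proof.
move=> rw; elim: u => //= l u IHu.
by rewrite /invw /= rev_cons -cats1 act_cat /= push_invl ?act_reduced.
Qed.

Lemma invw_reduced w : reduced w -> reduced (invw w).
Proof.
rewrite /reduced /invw all_rev rev_sorted all_map => /andP[aw sw].
apply/andP; split.
  by apply: sub_all aw => -[k|[]] //=; rewrite invg_eq1.
rewrite sorted_map; apply: sub_sorted sw => -[k|[x b]] [k'|[y c]] //=.
by rewrite eq_sym; case: b; case: c.
Qed.

Definition freeprod_of w : freeprod :=
  FreeProd (act_reduced w (isT : reduced [::])).
Definition freeprod_mul (a b : freeprod) : freeprod :=
  freeprod_of (normal_form a ++ normal_form b).
Definition freeprod_inv (a : freeprod) : freeprod :=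
  freeprod_of (invw (normal_form a)).

Lemma normal_form_inj : injective normal_form.
Proof. exact: val_inj. Qed.

Lemma normal_formM a b :
  normal_form (freeprod_mul a b) = act (normal_form a) (normal_form b).
Proof. by rewrite /= act_cat (act_nil (valP b)). Qed.

Fact freeprod_mulA : associative freeprod_mul.
Proof.
move=> a b c; apply: normal_form_inj; rewrite !normal_formM.
by rewrite act_act ?(valP b) ?(valP c).
Qed.

Fact freeprod_mul1 : left_id (freeprod_of [::]) freeprod_mul.
Proof. by move=> a; apply: normal_form_inj; rewrite /= (act_nil (valP a)). Qed.

Fact freeprod_mulr1 : right_id (freeprod_of [::]) freeprod_mul.
Proof. by move=> a; apply: normal_form_inj; rewrite /= cats0 (act_nil (valP a)). Qed.

Fact freeprod_mulV :
  left_inverse (freeprod_of [::]) freeprod_inv freeprod_mul.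
Proof.
move=> [w rw]; apply: normal_form_inj; rewrite /= act_cat.
by rewrite (act_nil (invw_reduced rw)) act_invw.
Qed.

Fact freeprod_mulrV :
  right_inverse (freeprod_of [::]) freeprod_inv freeprod_mul.
Proof.
move=> [w rw]; apply: normal_form_inj; rewrite /= act_cat.
rewrite (act_nil (act_reduced _ _)) // -{1}[w]invwK.
by rewrite act_invw.
Qed.

HB.instance Definition _ := isGroup.Build freeprod
  freeprod_mulA freeprod_mul1 freeprod_mulr1 freeprod_mulV freeprod_mulrV.

Definition freeprod_inK (k : K) : freeprod := freeprod_of [:: inl k].
Definition freeprod_inX (x : X) : freeprod := freeprod_of [:: inr (x, false)].

Definition freeprod_length (a : freeprod) : nat := size (normal_form a).

End FreeProduct.

Arguments push {K X} : simpl never.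

Section UniversalProperty.
Variables (K : groupType) (X : choiceType) (H : groupType).
Variables (f : K -> H) (g : X -> H).

Definition letter_eval (l : letter K X) : H :=
  match l with
  | inl k => f k
  | inr (x, b) => if b then (g x)^-1 else g x
  end.

Definition word_eval (w : seq (letter K X)) : H :=
  \prod_(l <- w) letter_eval l.

(* the homomorphism K * F(X) -> H that restricts to the homomorphism f on K and
   to g on the basis X *)
Definition freeprod_lift (a : freeprod K X) : H := word_eval (normal_form a).

Hypothesis fM : {morph f : k k' / k * k'}.

Let f1 : f 1 = 1.
Proof. by apply: (mulgI (f 1)); rewrite -fM !mulg1. Qed.

Lemma word_eval_push l w : word_eval (push l w) = letter_eval l * word_eval w.
Proof.
rewrite /word_eval; case: l => [k|[x b]]; case: w => [|[k'|[y c]] w];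
  rewrite /push ?big_cons ?big_nil //=.
- by case: eqVneq => [->|]; rewrite ?f1 ?big_cons ?big_nil ?mulg1.
- case: eqVneq => [->|_]; first by rewrite f1 mul1g big_cons.
  rewrite mulgA -fM; case: eqVneq => [->|_]; first by rewrite f1 mul1g.
  by rewrite big_cons.
- by case: eqVneq => [->|_]; rewrite ?f1 ?mul1g !big_cons.
- case: ifP => [/andP[/eqP-> bc]|_]; last by rewrite !big_cons.
  by move: bc; case: b; case: c => //= _; rewrite mulgA ?mulVg ?mulgV mul1g.
Qed.

Lemma word_eval_act u w : word_eval (act u w) = word_eval u * word_eval w.
Proof.
elim: u => [|l u IHu] /=; first by rewrite {2}/word_eval big_nil mul1g.
by rewrite word_eval_push IHu mulgA /word_eval big_cons.
Qed.

Lemma freeprod_lift_of w : freeprod_lift (freeprod_of w) = word_eval w.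
Proof.
by rewrite /freeprod_lift word_eval_act {2}/word_eval big_nil mulg1.
Qed.

Lemma freeprod_liftM : {morph freeprod_lift : a b / a * b}.
Proof. by move=> a b; rewrite /freeprod_lift normal_formM word_eval_act. Qed.

Lemma freeprod_lift_inK k : freeprod_lift (freeprod_inK X k) = f k.
Proof. by rewrite freeprod_lift_of /word_eval big_seq1. Qed.

Lemma freeprod_lift_inX x : freeprod_lift (freeprod_inX K x) = g x.
Proof. by rewrite freeprod_lift_of /word_eval big_seq1. Qed.

End UniversalProperty.

Section NormalForm.
Variables (K : groupType) (X : choiceType).
Implicit Types (a : freeprod K X) (w : seq (letter K X)).

Lemma freeprod_inKM : {morph @freeprod_inK K X : k k' / k * k'}.
Proof.
move=> k k'; apply: normal_form_inj;
by rewrite normal_formM /= act_push ?push_reduced // pushM.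
Qed.

Lemma freeprod_of_cons (l : letter K X) w :
  freeprod_of (l :: w) = freeprod_of [:: l] * freeprod_of w.
Proof.
apply: normal_form_inj; rewrite normal_formM /=.
by rewrite act_push // act_reduced.
Qed.

Lemma freeprod_of_invl (l : letter K X) :
  freeprod_of [:: invl l] = (freeprod_of [:: l])^-1.
Proof.
apply: (mulIg (freeprod_of [:: l])); rewrite mulVg.
by rewrite -freeprod_of_cons; apply: normal_form_inj; rewrite /= push_invl.
Qed.

Lemma word_eval_freeprod w :
  word_eval (@freeprod_inK K X) (@freeprod_inX K X) w = freeprod_of w.
Proof.
rewrite /word_eval; elim: w => [|l w IHw]; first by rewrite big_nil.
rewrite big_cons IHw freeprod_of_cons; congr (_ * _).
by case: l => [k|[x []]] //=; rewrite -freeprod_of_invl.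
Qed.

Lemma normal_formK : cancel (@normal_form K X) (@freeprod_of K X).
Proof. by move=> a; apply: normal_form_inj; rewrite /= act_nil ?(valP a). Qed.

Lemma freeprod_lift_unique (H : groupType) (h : freeprod K X -> H) :
  {morph h : a b / a * b} ->
  h =1 freeprod_lift (h \o @freeprod_inK K X) (h \o @freeprod_inX K X).
Proof.
move=> hM a; rewrite -{1}[a]normal_formK /freeprod_lift.
have h1 : h 1 = 1 by apply: (mulgI (h 1)); rewrite -hM !mulg1.
have hV b : h b^-1 = (h b)^-1.
  by apply: (mulIg (h b)); rewrite -hM !mulVg.
rewrite -word_eval_freeprod /word_eval (big_morph h hM h1).
by apply: eq_bigr => -[k|[x []]] _ //=; rewrite hV.
Qed.

Lemma size_push (l : letter K X) w : (size (push l w) <= (size w).+1)%N.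
Proof.
case: l => [k|[x b]]; case: w => [|[k'|[y c]] w]; rewrite /push //=.
- by case: (k == 1).
- case: (k == 1) => //; case: (k * k' == 1) => //=.
  by apply: leqW; apply: leqnSn.
- by case: (k == 1).
- case: ((x == y) && (b != c)) => //=.
  by apply: leqW; apply: leqnSn.
Qed.

Lemma push_size (l : letter K X) w :
  size (push l w) = (size w).+1 -> push l w = l :: w.
Proof.
have neS n : n = n.+1 -> False by elim: n => // n IHn [/IHn].
have neSS n : n = n.+2 -> False by elim: n => // n IHn [/IHn].
case: l => [k|[x b]]; case: w => [|[k'|[y c]] w]; rewrite /push //=.
- by case: (k == 1).
- case: (k == 1) => [/neS//|]; case: (k * k' == 1) => /= [/neSS//|].
  by move/neS.
- by case: (k == 1) => // /neS.
- by case: ((x == y) && (b != c)) => //= /neSS.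
Qed.

(* words may contain trivial or cancelling letters here, so the normal form is
   the unique shortest among all words representing a *)
Lemma normal_form_shortest a w :
  word_eval (@freeprod_inK K X) (@freeprod_inX K X) w = a ->
  (freeprod_length a <= size w)%N
  /\ (freeprod_length a = size w -> w = normal_form a).
Proof.
rewrite word_eval_freeprod => <-{a}; rewrite /freeprod_length /=.
elim: w => //= l w [IHle IHeq]; have le1 := size_push l (act w [::]).
split=> [|eq1]; first exact: leq_trans le1 _.
have eqw : size (act w [::]) = size w.
  by apply/eqP; rewrite eqn_leq IHle -ltnS -eq1.
by rewrite push_size ?eqw //; congr (_ :: _); apply: IHeq.
Qed.

End NormalForm.

Section Subgroups.
Variable G : groupType.

Definition subgroup (H : set G) : Prop :=
  H 1 /\ forall x y, H x -> H y -> H (x * y^-1).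

Definition generated (A : set G) : set G := smallest subgroup A.

End Subgroups.

Section Quasimorphisms.
Variables (R : realType) (G : groupType).
Implicit Type phi : G -> R.

Definition defect phi : \bar R :=
  ereal_sup [set `|phi p.1 + phi p.2 - phi (p.1 * p.2)%g|%:E%R
            | p in [set: G * G]]%classic.

Definition quasimorphism phi : Prop := (defect phi < +oo)%E.

End Quasimorphisms.

Section Control.
Variables (R : realType) (G : groupType) (P : {pred G}) (K : subGroupType P).
Variable X : {fset G}.

Definition theta : freeprod K X -> G := freeprod_lift \val \val.

Lemma thetaM : {morph theta : a b / a * b}.
Proof. exact/freeprod_liftM/gmulfM. Qed.

Definition eta : freeprod K X -> K := freeprod_lift id (fun=> 1).

Lemma etaM : {morph eta : a b / a * b}.
Proof. exact: freeprod_liftM. Qed.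

Definition qm_tilde (phi : K -> R) : freeprod K X -> R := phi \o eta.

Definition controlled (phi : K -> R) (f : nat -> R) : Prop :=
  forall (n : nat) (a : freeprod K X),
    theta a = 1 -> (freeprod_length a <= n)%N -> (`|qm_tilde phi a| <= f n)%R.

Definition linearly_controlled (phi : K -> R) (C0 : R) : Prop :=
  controlled phi (fun n => (C0 * n%:R + C0)%R).

End Control.

(* Main.v *)
(* Read a word w of length n letter by letter, once in G and once through eta.
   The two images agree on the letters from K and differ by a bounded amount on
   the finitely many letters x and x^-1, so their values under psi differ by
   O(n).  When w lies in ker theta, the first value is the constant psi 1. *)
Require Import Defs.
From HB Require Import structures.
Set Warnings "-notation-incompatible-prefix,-notation-overridden,-ambiguous-paths".
From mathcomp Require Import all_boot all_order all_algebra finmap.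
From mathcomp Require Import all_classical all_reals ereal.
From mathcomp Require Import lra.

Import Order.TTheory GRing.Theory Num.Theory.

(** The defect is a supremum in the extended reals. It dominates the real value at (1, 1), so it is
    not -oo, and its real part serves as [D]. *)
Lemma quasimorphism_bound (R : realType) (G : groupType) (phi : G -> R) :
  quasimorphism phi ->
  exists D : R, forall g h, (`|phi g + phi h - phi (g * h)%g| <= D)%R.
Proof.
rewrite /quasimorphism => defect_fin.
have le_defect g h :
    ((`|phi g + phi h - phi (g * h)%g|)%:E%R <= defect phi)%E.
  by apply: ereal_sup_ubound; exists (g, h).
have defectE : defect phi \is a fin_num.
  rewrite fin_numE (lt_eqF defect_fin) andbT -ltNye.
  exact: lt_le_trans (ltNyr _) (le_defect 1%g 1%g).
by exists (fine (defect phi)) => g h; rewrite -lee_fin fineK.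
Qed.

Section WordComparison.
Local Open Scope ring_scope.
Context {R : realType} {K H : groupType} {X : choiceType}.
Context {f1 f2 : K -> H} {g1 g2 : X -> H}.

(** Splitting off the first letter costs at most [D] in each of the two evaluations, and the letter
    itself contributes at most [M]: in all 2D + M per letter. *)
Lemma quasimorphism_word_dist {psi : H -> R} {D M : R} :
  (forall g h, `|psi g + psi h - psi (g * h)%g| <= D) ->
  (forall l : letter K X,
    `|psi (letter_eval f1 g1 l) - psi (letter_eval f2 g2 l)| <= M) ->
  forall w : seq (letter K X),
    `|psi (word_eval f1 g1 w) - psi (word_eval f2 g2 w)|
      <= (D *+ 2 + M) * (size w)%:R.
Proof.
move=> psiD psiM; rewrite /word_eval.
elim=> [|l w IHw]; first by rewrite !big_nil subrr normr0 mulr0.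
rewrite !big_cons /= -natr1 mulrDr mulr1.
move: (psiD (letter_eval f1 g1 l) (\prod_(l <- w) letter_eval f1 g1 l)%g).
move: (psiD (letter_eval f2 g2 l) (\prod_(l <- w) letter_eval f2 g2 l)%g).
move: (psiM l) IHw; rewrite !ler_norml.
by move=> /andP[? ?] /andP[? ?] /andP[? ?] /andP[? ?]; apply/andP; split; lra.
Qed.

End WordComparison.

(** Since the inclusion of [K] is a homomorphism, [eta] can be read in [G], as an evaluation of the
    same word that [theta] evaluates. *)
Lemma val_eta (G : groupType) (P : {pred G}) (K : subGroupType P)
    (X : {fset G}) (a : freeprod K X) :
  \val (Defs.eta a) = word_eval (\val : K -> G) (fun=> 1%g) (normal_form a).
Proof.
rewrite /Defs.eta /freeprod_lift /word_eval (big_morph _ gmulfM gmulf1).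
by apply: eq_bigr => -[k|[x []]] _ //=; rewrite ?invg1 gmulf1.
Qed.

Theorem lemma1p4 (R : realType) (G : groupType) (P : {pred G})
    (K : subGroupType P) (X : {fset G})
    (genG : generated ([set` P] `|` [set` X])%classic = [set: G]%classic)
    (phi : K -> R) (phi_qm : quasimorphism phi)
    (phi_ext : exists psi : G -> R,
        quasimorphism psi /\ forall k : K, psi (\val k) = phi k) :
  exists C0 : R, linearly_controlled X phi C0.
Proof.
case: phi_ext => psi [/quasimorphism_bound[D psiD] psiE].
pose dist (x : X) (b : bool) : R :=
  `|psi 1%g - psi (if b then (\val x)^-1 else \val x)%g|%R.
(* A sum in place of a maximum: [X] is finite and the terms are nonnegative, so [M] bounds each of
   them. *)
pose M : R := (\sum_(x : X) (dist x false + dist x true))%R.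
have dist_ge0 x b : (0 <= dist x b)%R by exact: normr_ge0.
have distM x b : (dist x b <= M)%R.
  rewrite /M (bigD1 x) //= -[leLHS]addr0 lerD //.
    by case: b; rewrite ?lerDl ?lerDr.
  by apply: sumr_ge0 => y _; exact: addr_ge0.
have M_ge0 : (0 <= M)%R by apply: sumr_ge0 => x _; exact: addr_ge0.
have D_ge0 : (0 <= D)%R := le_trans (normr_ge0 _) (psiD 1%g 1%g).
have letterM (l : letter K X) :
    (`|psi (letter_eval (\val : K -> G) (fun=> 1%g) l)
       - psi (letter_eval (\val : K -> G) \val l)| <= M)%R.
  case: l => [k|[x b]] /=; first by rewrite subrr normr0.
  by rewrite invg1 if_same; exact: distM.
(* One constant is both slope and intercept: the slope has to cover 2D + M, the intercept the
   absolute value of psi(1). *)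
exists (D *+ 2 + M + `|psi 1%g|)%R => n a theta_a le_an.
rewrite /qm_tilde /= -psiE val_eta.
move: (quasimorphism_word_dist psiD letterM (normal_form a)).
rewrite -[word_eval \val \val _]/(theta a) theta_a => dist_a.
(* The value at [a] is its difference from psi(1), bounded by the linear term, plus psi(1), bounded
   by the constant term. *)
rewrite -[X in (`|X|)%R](subrK (psi 1%g)).
apply: le_trans (ler_normD _ _) _; apply: lerD.
  apply: le_trans dist_a _; apply: ler_pM; rewrite ?ler_nat //.
    by rewrite addr_ge0 ?mulrn_wge0.
  by rewrite lerDl.
by rewrite lerDr addr_ge0 ?mulrn_wge0.
Qed.
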